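(* Let $\rho$ be a dynamic shortfall risk measure with a strictly increasing loss function $l$. Then $\rho$ is time-consistent if and only if there exists $\beta\ge0$ such that the loss function satisfies $$l(x)=\begin{cases}\exp(2\beta x)-1,&\text{if }\beta\neq0,\\ x,&\text{else.}\end{cases}$$
   Context: Fix $T>0$. $(\Omega,\mathcal F,\mathbb P)$ is a probability space carrying a $d$-dimensional Brownian motion with augmented filtration $(\mathcal F_t)_{0\le t\le T}$. $L^\infty(\mathcal G)$ is the space of essentially bounded $\mathcal G$-measurable random variables. A loss function is a function $l:\mathbb R\to\mathbb R$ that is increasing ($l(x)\ge l(y)$ if $x\ge y$), convex, with $\inf l<0$ and $l(0)=0$. The dynamic shortfall risk measure with loss function $l$ is the family $\rho=(\rho_{\sigma,\tau})$, indexed by stopping times $\sigma\le\tau\le T$, given for $X\in L^\infty(\mathcal F_\tau)$ by $$\rho_{\sigma,\tau}(X):=\operatorname{ess\,inf}\{m\in L^\infty(\mathcal F_\sigma):\ \mathbb E[l(X-m)|\mathcal F_\sigma]\le0\}.$$ $\rho$ is time-consistent if for all stopping times $\iota\le\sigma\le\tau\le T$ and all $X\in L^\infty(\mathcal F_\tau)$, $\rho_{\iota,\sigma}(\rho_{\sigma,\tau}(X))=\rho_{\iota,\tau}(X)$ a.s.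
   Formalization: The loss function is characterized only up to a positive factor c: l(x)=c(exp(2βx)-1) or l(x)=cx. Without c the ''only if'' fails: l(x)=2x is a strictly increasing loss function with time-consistent ρ (conditional expectation), but is not of the stated form. *)

(* Defs.v *)
From HB Require Import structures.
From mathcomp Require Import all_boot all_order all_algebra.
From mathcomp Require Import all_classical all_reals all_analysis.

Set Implicit Arguments.
Unset Strict Implicit.
Unset Printing Implicit Defensive.

Import Order.TTheory GRing.Theory Num.Theory.
Import numFieldNormedType.Exports.

Local Open Scope classical_set_scope.
Local Open Scope ring_scope.

(* Sub-sigma-algebras of Omega are systems of sets G : set (set Omega). Random
   variables are honest functions; elements of L^oo are represented by their
   representatives, and identities between them are stated almost surely. *)
Section random_variables.
Context {R : realType} {disp : measure_display} {Omega : measurableType disp}.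
Variable P : probability Omega R.

Definition measurable_wrt (G : set (set Omega)) (X : Omega -> R) : Prop :=
  forall B : set R, measurable B -> G (X @^-1` B).

Definition Linfty (G : set (set Omega)) : set (Omega -> R) :=
  [set X | measurable_wrt G X /\
           exists C : R, \forall w \ae P, `|X w| <= C].

Definition is_cond_expectation (G : set (set Omega)) (X Y : Omega -> R) :
    Prop :=
  [/\ measurable_wrt G Y,
      P.-integrable setT (EFin \o Y) &
      forall A : set Omega, G A ->
        (\int[P]_(w in A) (Y w)%:E = \int[P]_(w in A) (X w)%:E)%E].

(* A version of E[X | G]; it is 0 when X has no conditional expectation. *)
Definition cond_expectation (G : set (set Omega)) (X : Omega -> R) :
    Omega -> R :=
  xget (fun=> 0) [set Y | is_cond_expectation G X Y].

(* Y is an essential infimum of the family S (not of a single function, as in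
   the library's ess_inf): the a.s. greatest random variable that is a.s. below
   every member of S. *)
Definition is_family_ess_inf (S : set (Omega -> R)) (Y : Omega -> R) : Prop :=
  [/\ measurable_fun setT Y,
      forall m, S m -> \forall w \ae P, Y w <= m w &
      forall Z : Omega -> R, measurable_fun setT Z ->
        (forall m, S m -> \forall w \ae P, Z w <= m w) ->
        \forall w \ae P, Z w <= Y w].

Definition family_ess_inf (S : set (Omega -> R)) : Omega -> R :=
  xget (fun=> 0) [set Y | is_family_ess_inf S Y].

End random_variables.

Section brownian.
Context {R : realType} {disp : measure_display} {Omega : measurableType disp}.
Variables (P : probability Omega R) (d : nat) (T : R).
(* W t i w is the i-th coordinate at time t; only t in [0, T] matters. *)
Variable W : R -> 'I_d -> Omega -> R.

Definition past_events (t : R) : set (set Omega) :=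
  [set A | exists (s : R) (i : 'I_d) (B : set R),
    [/\ 0 <= s <= t, measurable B & A = W s i @^-1` B]].

Definition natural_filtration (t : R) : set (set Omega) :=
  <<s past_events t >>.

(* The null sets are taken in the ambient sigma-algebra, so that the augmented
   filtration is made of sub-sigma-algebras of it even if P is not complete. *)
Definition augmented_filtration (t : R) : set (set Omega) :=
  <<s past_events t `|` [set N | measurable N /\ P N = 0%E] >>.

Definition increment_events (s t : R) : set (set Omega) :=
  <<s [set A | exists (i : 'I_d) (B : set R),
        measurable B /\ A = (fun w => W t i w - W s i w) @^-1` B] >>.

(* The second parameter of normal_prob is the standard deviation. *)
Definition brownian_motion : Prop :=
  [/\ forall (t : R) i, 0 <= t <= T -> measurable_fun setT (W t i),
      forall i, \forall w \ae P, W 0 i w = 0,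
      forall s t : R, 0 <= s -> s < t -> t <= T ->
        forall A C, natural_filtration s A -> increment_events s t C ->
          P (A `&` C) = (P A * P C)%E,
      forall s t : R, 0 <= s -> s < t -> t <= T ->
        forall B : 'I_d -> set R, (forall i, measurable (B i)) ->
          P [set w | forall i, B i (W t i w - W s i w)] =
          (\prod_(i < d) normal_prob 0 (Num.sqrt (t - s)) (B i))%E &
      \forall w \ae P, forall i, {within `[0, T], continuous (W ^~ i ^~ w)}].

Definition stopping_time (tau : Omega -> R) : Prop :=
  (forall w, 0 <= tau w <= T) /\
  (forall t : R, 0 <= t <= T -> augmented_filtration t [set w | tau w <= t]).

Definition stopped_sigma_algebra (tau : Omega -> R) : set (set Omega) :=
  [set A | augmented_filtration T A /\
    forall t : R, 0 <= t <= T ->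
      augmented_filtration t (A `&` [set w | tau w <= t])].

(* rho sigma tau X stands for rho_{sigma,tau}(X). *)
Definition time_consistent
    (rho : (Omega -> R) -> (Omega -> R) -> (Omega -> R) -> (Omega -> R)) :
    Prop :=
  forall iota sigma tau : Omega -> R,
    stopping_time iota -> stopping_time sigma -> stopping_time tau ->
    (forall w, iota w <= sigma w) -> (forall w, sigma w <= tau w) ->
    forall X, Linfty P (stopped_sigma_algebra tau) X ->
      \forall w \ae P,
        rho iota sigma (rho sigma tau X) w = rho iota tau X w.

(* tau only determines the domain L^oo(F_tau) of rho_{sigma,tau}; it does not
   enter the formula. *)
Definition shortfall_risk_measure (l : R -> R) (sigma tau X : Omega -> R) :
    Omega -> R :=
  family_ess_inf P
    [set m | Linfty P (stopped_sigma_algebra sigma) m /\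
       \forall w \ae P,
         cond_expectation P (stopped_sigma_algebra sigma)
           (fun w' => l (X w' - m w')) w <= 0].

End brownian.

Definition loss_function {R : realType} (l : R -> R) : Prop :=
  [/\ {homo l : x y / x <= y},
      convex_function (setT : set R^o) l,
      (ereal_inf (range (EFin \o l)) < 0)%E &
      l 0 = 0].

(* Main.v *)
Require Import Defs.
From mathcomp Require Import all_boot all_order all_algebra.
From mathcomp Require Import finmap.
From mathcomp Require Import all_classical all_reals all_analysis.
From mathcomp Require Import measurable_realfun ring lra.

Import Order.TTheory GRing.Theory Num.Theory.
Import numFieldNormedType.Exports.

Local Open Scope classical_set_scope.
Local Open Scope ring_scope.

(** The risk [rho_{sigma,tau}(X)] is the solution [Y] of
    [E[l (X - Y) | F_sigma] = 0], as soon as this equation has a bounded solution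
    measurable for [F_sigma]: because [l] is strictly increasing, an acceptable [m]
    cannot be smaller than [Y] with positive probability
    ([root_is_family_ess_inf]). Both implications compute risks by exhibiting such
    solutions.

    Sufficiency. For a multiple of [expR (2 * beta * x) - 1] or of the identity,
    [l (x - y)] is the product of [phi x - phi y] and a positive function of [y],
    with [phi] the exponential or the identity. The solution is then the
    conditional mean [phi^-1 (E[phi (X) | F_sigma])] ([quasi_mean_root]), and time
    consistency is the tower property ([quasi_mean_time_consistent]).

    Necessity. The times [0], [T / 2], [T] suffice. Increments of the Brownian
    motion over the two halves of the time interval supply two independent events
    of arbitrary probabilities, the first one known at time [T / 2], and the
    sigma-algebra at time [0] is trivial. For payoffs with three values built from
    these events the equations defining the risks are finite sums, and time
    consistency says that a lottery between [x] and [y] whose risk is [0] may be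
    replaced by the constant [0] inside a larger lottery
    ([time_consistent_substitution]). Hence
    [l x * (l (y + h) - l h) = l y * (l (x + h) - l h)] for [y < 0 < x] and every
    [h] ([time_consistent_exchange]), a functional equation whose convex
    increasing solutions are the announced ones ([exponential_or_linear]). *)

(** * Convex functions and the functional equation *)

Section real_functions.
Context {R : realType}.
Implicit Types l g f : R -> R.

Lemma convex_chord l : convex_function (setT : set R^o) l ->
  forall x y t : R, 0 <= t <= 1 ->
    l (t * x + (1 - t) * y) <= t * l x + (1 - t) * l y.
Proof.
move=> cl x y t /andP[t0 t1].
have := cl (Itv01 t0 t1) x y; rewrite !inE => /(_ I I).
exact.
Qed.

Lemma convex_slope l : convex_function (setT : set R^o) l ->
  forall x y z, x < y -> y < z ->
    (l y - l x) * (z - x) <= (l z - l x) * (y - x).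
Proof.
move=> /convex_chord cl x y z xy yz.
have zx : 0 < z - x by lra.
have := cl z x ((y - x) / (z - x)).
have -> : (y - x) / (z - x) * z + (1 - (y - x) / (z - x)) * x = y.
  by field; lra.
have t01 : 0 <= (y - x) / (z - x) <= 1.
  by rewrite divr_ge0 ?ler_pdivrMr ?mul1r//=; lra.
move=> /(_ t01); rewrite -(ler_pM2r zx) => h.
suff : ((y - x) / (z - x) * l z + (1 - (y - x) / (z - x)) * l x) * (z - x)
  = (y - x) * l z + (z - y) * l x by nra.
by field; lra.
Qed.

(** To the left of [a + 1] every chord of [l] is flatter than the chord over
    [[a + 1, a + 2]], whose slope [K] is therefore a local Lipschitz constant at
    [a]. Monotonicity gives the other bound on the increments. *)
Lemma convex_increasing_continuous l : {homo l : x y / x < y} ->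
  convex_function (setT : set R^o) l -> continuous l.
Proof.
move=> hinc cl a.
have slope := convex_slope _ cl.
pose K := l (a + 2) - l (a + 1).
have K0 : 0 < K by rewrite subr_gt0 hinc//; lra.
have lip x y : x < y -> y < a + 1 -> l y - l x <= K * (y - x).
  move=> xy ya.
  have s1 := slope x y (a + 1) xy ya.
  have s2 := slope x (a + 1) (a + 2) ltac:(lra) ltac:(lra).
  have ax : 0 < a + 1 - x by lra.
  have yx : 0 < y - x by lra.
  have s3 : l (a + 1) - l x <= K * (a + 1 - x) by rewrite /K; nra.
  rewrite -(ler_pM2r ax) (le_trans s1)//.
  by rewrite mulrAC ler_pM2r.
apply/cvgrPdist_le => /= e e0.
near=> x.
have xa1 : `|a - x| < 1.
  by near: x; exact: (@nbhsx_ballx _ _ a 1 ltr01).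
have xae : `|a - x| < e / K.
  by near: x; apply: (@nbhsx_ballx _ _ a (e / K)); rewrite divr_gt0.
rewrite ltr_pdivlMr// in xae.
move: xa1 xae; rewrite !ltr_norml => /andP[xa1 _] xae.
have [ax|ax|->] := ltgtP a x.
- have := lip a x ax ltac:(lra); have := hinc a x ax.
  move: xae; rewrite (ltr0_norm (_ : a - x < 0)) ?subr_lt0// => xae lax h.
  by rewrite ltr0_norm ?subr_lt0//; lra.
- have := lip x a ax ltac:(lra); have := hinc x a ax.
  move: xae; rewrite (gtr0_norm (_ : 0 < a - x)) ?subr_gt0// => xae lax h.
  by rewrite gtr0_norm ?subr_gt0//; lra.
- by rewrite subrr normr0 ltW.
Unshelve. all: by end_near.
Qed.

(** Cauchy's equation: by monotonicity [f (n x)] lies between the values of [f]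
    at the two integers around [n x], so [n |f x - x f 1|] is bounded in [n]. *)
Lemma additive_nondecreasing_linear f :
  (forall x y, f (x + y) = f x + f y) -> {homo f : x y / x <= y} ->
  forall x, f x = x * f 1.
Proof.
move=> fD fnd x.
have f0 : f 0 = 0 by have := fD 0 0; rewrite addr0; lra.
have fN y : f (- y) = - f y by have := fD y (- y); rewrite subrr f0; lra.
have fM n y : f (n%:R * y) = n%:R * f y.
  elim: n => [|n IH]; first by rewrite !mul0r f0.
  by rewrite -natr1 !mulrDl !mul1r fD IH.
have fz (m : int) : f m%:~R = m%:~R * f 1.
  have fn (n : nat) : f n%:R = n%:R * f 1 by rewrite -{1}(mulr1 n%:R) fM.
  by case: m => n; rewrite ?NegzE ?mulrNz ?fN ?fn ?mulNr// -fn.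
have f1 : 0 <= f 1 by rewrite -f0 fnd.
have bd n : n%:R * `|f x - x * f 1| <= f 1.
  rewrite -[n%:R]ger0_norm// -normrM mulrBr -fM.
  have /andP[h1 /ltW h2] := Num.Theory.floor_itv (n%:R * x).
  have := fnd _ _ h1; have := fnd _ _ h2; rewrite !fz.
  move: h1 h2; rewrite intrD; set m := (Num.floor _)%:~R => h1 h2 h3 h4.
  rewrite ler_norml; apply/andP; split; nra.
apply/eqP; rewrite -subr_eq0 -normr_le0 leNgt; apply/negP => e0.
have := bd (Num.bound (f 1 / `|f x - x * f 1|)).
have : f 1 / `|f x - x * f 1| < (Num.bound (f 1 / `|f x - x * f 1|))%:R.
  by rewrite Num.Theory.archi_boundP// divr_ge0.
by rewrite ltr_pdivrMr// => /lt_le_trans h /h; rewrite ltxx.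
Qed.

(** The exchange identity says that the quotient [(l (x + h) - l h) / l x] takes
    the same value [g h] at every positive and every negative [x]. Hence
    [l (x + h) = l h + g h * l x], and exchanging [x] and [h] in this equation
    yields [g = 1 + a * l] for a constant [a], nonnegative by convexity. If
    [a = 0] then [l] is additive. Otherwise [g] is a positive multiplicative
    function and [ln g] is additive; both cases end with Cauchy's equation. *)
Lemma exponential_or_linear l : {homo l : x y / x < y} ->
  convex_function (setT : set R^o) l -> l 0 = 0 ->
  (forall x y h, y < 0 -> 0 < x ->
     l x * (l (y + h) - l h) = l y * (l (x + h) - l h)) ->
  exists2 beta : R, 0 <= beta & exists2 c : R, 0 < c &
    forall x, l x = c * (if beta != 0 then expR (2 * beta * x) - 1 else x).
Proof.
move=> hinc cl l0 hl.
have lpos x : 0 < x -> 0 < l x by move=> x0; rewrite -l0 hinc.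
have l1 := lpos 1 ltr01.
have lN1 : l (-1) < 0 by rewrite -l0 hinc//; lra.
pose g h := (l (1 + h) - l h) / l 1.
have g1 h : g h * l 1 = l (1 + h) - l h by rewrite divfK// gt_eqF.
have lneg x h : x < 0 -> l (x + h) = l h + g h * l x.
  move=> x0; apply: (mulfI (lt0r_neq0 l1)).
  have := hl 1 x h x0 ltr01; rewrite -g1; lra.
have lD x h : l (x + h) = l h + g h * l x.
  have [x0|x0|->] := ltgtP x 0; first exact: lneg.
    have := hl x (-1) h ltac:(lra) x0; rewrite lneg; last lra.
    move=> h1; apply: (mulfI (ltr0_neq0 lN1)); lra.
  by rewrite add0r l0 mulr0 addr0.
have gnd : {homo g : x y / x <= y}.
  move=> x y; rewrite le_eqVlt => /predU1P[->//|xy].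
  rewrite ler_pM2r ?invr_gt0//.
  (* [g] is, up to the factor [l 1], the slope of the chord of length 1, which
     grows to the right: compare both chords with the one over [[x, 1 + y]]. *)
  have slope := convex_slope _ cl.
  have s1 := slope x (1 + x) (1 + y) ltac:(lra) ltac:(lra).
  have s2 := slope x y (1 + y) ltac:(lra) ltac:(lra).
  nra.
pose a := (g 1 - 1) / l 1.
have ga h : g h = 1 + a * l h.
  have al1 : a * l 1 = g 1 - 1 by rewrite divfK ?gt_eqF.
  have := lD 1 h; rewrite addrC lD => e.
  by apply: (mulIf (lt0r_neq0 l1)); rewrite mulrDl (mulrAC a) al1; lra.
have a0 : 0 <= a.
  have := gnd 0 1 ler01; rewrite !ga l0 mulr0 addr0.
  by rewrite lerDl pmulr_lge0.
have [a00|an0] := eqVneq a 0.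
  exists 0 => //; exists (l 1) => // x; rewrite eqxx/= mulrC.
  apply: additive_nondecreasing_linear; last by apply: ltW_homo.
  by move=> y z; rewrite lD ga a00; lra.
have {an0}a0 : 0 < a by rewrite lt_neqAle eq_sym an0.
have gD x h : g (x + h) = g x * g h by rewrite !ga lD ga; lra.
have gpos h : 0 < g h by rewrite divr_gt0// subr_gt0 hinc//; lra.
pose k := ln (g 1).
have gE x : g x = expR (x * k).
  have <- : ln (g x) = x * k; last by rewrite lnK ?posrE.
  apply: (additive_nondecreasing_linear (fun y => ln (g y))) => [y z|y z yz].
    by rewrite gD lnM ?posrE.
  by rewrite ler_ln ?posrE// gnd.
have k0 : 0 < k by rewrite ln_gt0// ga ltrDl mulr_gt0.
exists (k / 2); first by rewrite divr_ge0// ltW.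
exists a^-1; first by rewrite invr_gt0.
move=> x; rewrite gt_eqF ?divr_gt0//=.
have -> : 2 * (k / 2) * x = x * k by field.
by rewrite -gE ga addrAC subrr add0r mulKf// gt_eqF.
Qed.
End real_functions.

(** * Conditional expectations and complete sub-sigma-algebras *)

Definition ae_bounded {R : realType} {disp : measure_display}
    {Omega : measurableType disp} (P : probability Omega R) (X : Omega -> R) :=
  exists C : R, \forall w \ae P, `|X w| <= C.

Section almost_sure.
Context {R : realType} {disp : measure_display} {Omega : measurableType disp}.
Variable P : probability Omega R.
Implicit Types (A : set Omega) (X Y f g : Omega -> R).

Lemma ae_bounded_integrable X A : measurable A -> measurable_fun setT X ->
  ae_bounded P X -> P.-integrable A (EFin \o X).
Proof.
move=> mA mX [C XC].
apply: (integrableS measurableT) => //.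
apply/integrableP; split; first exact/measurable_EFinP.
apply: (@le_lt_trans _ _ (\int[P]_w (`|C|%:E))%E).
  apply: ae_ge0_le_integral => //=.
    by apply/measurable_EFinP; apply: measurableT_comp.
  apply: filterS XC => w XC _; rewrite lee_fin (le_trans XC)//.
  exact: ler_norm.
by rewrite integral_cst//= probability_setT mule1 ltry.
Qed.

Lemma measure0_of_integral_le0 A f : measurable A ->
  P.-integrable A (EFin \o f) -> (forall w, A w -> 0 < f w) ->
  (\int[P]_(w in A) (f w)%:E <= 0)%E -> P A = 0%E.
Proof.
move=> mA fi fpos fle.
have f0 : (\int[P]_(w in A) `|(f w)%:E| = 0)%E.
  apply/eqP; rewrite eq_le integral_ge0 ?andbT//=.
  apply: le_trans fle; rewrite le_eqVlt; apply/orP; left; apply/eqP.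
  by apply: eq_integral => w /[!inE] Aw; rewrite gtr0_norm// fpos.
have := (ae_eq_integral_abs P mA (measurable_int _ fi)).1 f0.
case=> N [mN N0 sub]; apply: (subset_measure0 mA mN _ N0) => w Aw.
apply: sub => /= /(_ Aw) [] fw0.
by have := fpos w Aw; rewrite fw0 ltxx.
Qed.

Lemma measurable_lt_set X Y : measurable_fun setT X -> measurable_fun setT Y ->
  measurable [set w | X w < Y w].
Proof.
by move=> mX mY; rewrite -[X in measurable X]setTI; apply: measurable_fun_ltr.
Qed.

Lemma ae_le_measure0 X Y : measurable_fun setT X -> measurable_fun setT Y ->
  P [set w | Y w < X w] = 0%E -> \forall w \ae P, X w <= Y w.
Proof.
move=> mX mY YX0; exists [set w | Y w < X w]; split => //.
  exact: measurable_lt_set.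
by move=> w /= /negP; rewrite -ltNge.
Qed.

Lemma ae_le_integral A f g : measurable A ->
  P.-integrable A (EFin \o f) -> P.-integrable A (EFin \o g) ->
  (\forall w \ae P, f w <= g w) ->
  (\int[P]_(w in A) (f w)%:E <= \int[P]_(w in A) (g w)%:E)%E.
Proof.
move=> mA fi gi fg.
have mf := (measurable_EFinP _ _).1 (measurable_int _ fi).
have mg := (measurable_EFinP _ _).1 (measurable_int _ gi).
have mfg : measurable_fun A (EFin \o (f \max g)).
  by apply/measurable_EFinP; exact: measurable_maxr.
have gfg : ae_eq P A (EFin \o g) (EFin \o (f \max g)).
  by apply: filterS fg => w fgw _ /=; rewrite max_r.
rewrite (ae_eq_integral (EFin \o (f \max g)) (EFin \o g))//; last first.
  exact: measurable_int gi.
apply: le_integral => //; last first.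
  by move=> w _ /=; rewrite lee_fin le_max lexx.
apply: (le_integrable mA mfg _
  (integrableD mA (integrable_abse fi) (integrable_abse gi))).
move=> w _ /=; rewrite lee_fin [leRHS]ger0_norm ?addr_ge0//.
by case: (leP (f w) (g w)) => _; rewrite ?lerDl ?lerDr.
Qed.
End almost_sure.

(** The null sets are those of the ambient sigma-algebra, so that an ambient
    random variable almost surely equal to a [G]-measurable one is itself
    [G]-measurable. This matters because an essential infimum is only asked to
    be measurable for the ambient sigma-algebra. *)
Definition complete_sub_sigma_algebra {R : realType} {disp : measure_display}
    {Omega : measurableType disp} (P : probability Omega R)
    (G : set (set Omega)) :=
  [/\ sigma_algebra setT G, G `<=` measurable &
      forall N, measurable N -> P N = 0%E -> G N].

Section sub_sigma_algebra.
Context {R : realType} {disp : measure_display} {Omega : measurableType disp}.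
Variables (P : probability Omega R) (G : set (set Omega)).
Hypothesis hG : complete_sub_sigma_algebra P G.
Implicit Types (A N : set Omega) (X Y Z : Omega -> R).

Let sG : sigma_algebra setT G. Proof. by case: hG. Qed.
Let GE : <<s G >> = G. Proof. exact: sigma_algebra_id. Qed.
Let GT := g_sigma_algebraType G.

Lemma sub_sigma_measurable A : G A -> measurable A.
Proof. by case: hG => _ + _; exact. Qed.

Lemma sub_sigma_null N : measurable N -> P N = 0%E -> G N.
Proof. by case: hG => _ _; exact. Qed.

Lemma sub_sigmaT : G setT.
Proof. by rewrite -GE; exact: (@measurableT _ GT). Qed.

Lemma sub_sigmaC A : G A -> G (~` A).
Proof. by rewrite -GE; exact: (@measurableC _ GT). Qed.

Lemma sub_sigmaI A B : G A -> G B -> G (A `&` B).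
Proof. by rewrite -GE; exact: (@measurableI _ GT). Qed.

Lemma sub_sigmaU A B : G A -> G B -> G (A `|` B).
Proof. by rewrite -GE; exact: (@measurableU _ GT). Qed.

Lemma measurable_wrtP X :
  measurable_wrt G X <-> measurable_fun (setT : set GT) (X : GT -> R).
Proof.
split=> [mX _ B mB|mX B mB]; rewrite ?setTI.
  by apply: sub_sigma_algebra; exact: mX.
by rewrite -GE -[X in <<s _ >> X]setTI; exact: (mX measurableT).
Qed.

Lemma measurable_wrt_measurable X : measurable_wrt G X -> measurable_fun setT X.
Proof.
by move=> mX _ B mB; rewrite setTI; apply: sub_sigma_measurable; exact: mX.
Qed.

(** Outside the null set [N] where the variables differ the preimages agree, and
    inside it every ambient measurable set belongs to [G]. *)
Lemma measurable_wrt_ae X Y : measurable_wrt G X -> measurable_fun setT Y ->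
  (\forall w \ae P, X w = Y w) -> measurable_wrt G Y.
Proof.
move=> mX mY [N [mN N0 sub]] B mB.
have GN := sub_sigma_null _ mN N0.
have -> : Y @^-1` B = (X @^-1` B `&` ~` N) `|` (Y @^-1` B `&` N).
  apply/seteqP; split=> w /=.
    move=> YB; have [Nw|Nw] := pselect (N w); [by right|left; split=> //].
    by have -> : X w = Y w by apply: contrapT => /sub.
  case=> [[XB Nw]|[//]].
  by have <- : X w = Y w by apply: contrapT => /sub.
apply: sub_sigmaU; first by apply: sub_sigmaI; [exact: mX|exact: sub_sigmaC].
have mYB : measurable (Y @^-1` B `&` N).
  by apply: measurableI => //; rewrite -[X in measurable X]setTI; exact: mY.
by apply: sub_sigma_null => //; apply: (subset_measure0 _ mN _ N0).
Qed.

Lemma Linfty_ae X Y : Linfty P G X -> measurable_fun setT Y ->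
  (\forall w \ae P, X w = Y w) -> Linfty P G Y.
Proof.
move=> [mX [C XC]] mY XY; split; first exact: measurable_wrt_ae XY.
by exists C; apply: filterS2 XC XY => w + <-.
Qed.

Lemma measurable_sub_id : measurable_fun (setT : set Omega) (id : Omega -> GT).
Proof.
move=> _ B; rewrite setTI preimage_id => mB.
by apply: sub_sigma_measurable; rewrite -GE.
Qed.

(** The Radon-Nikodym derivative, computed on the coarse measurable space, of
    the charge [A |-> \int_A X dP] with respect to the restriction of [P]. Both
    set functions reach the coarse space as images under the identity map. *)
Lemma cond_expectation_exists X : P.-integrable setT (EFin \o X) ->
  exists Y, is_cond_expectation P G X Y.
Proof.
move=> iX.
pose phi : {mfun Omega >-> GT} := mfun_Sub (mem_set measurable_sub_id).
pose mu := distribution P phi.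
(* As a charge, the image depends on a proof that [phi] is measurable. *)
pose nu' : {charge set GT -> \bar R} :=
  pushforward (induced_charge iX) phi.
pose nu := nu' measurable_sub_id.
have numu : nu `<< mu.
  apply/null_content_dominatesP => A mA; rewrite /mu /distribution /= => muA0.
  rewrite /nu/= /pushforward /induced_charge.
  apply: null_set_integral => //=.
    by apply: sub_sigma_measurable; rewrite -GE.
  by apply: measurable_funTS; exact: measurable_int iX.
pose f := Radon_Nikodym nu mu.
have fE : f = EFin \o (fine \o f).
  by apply/funext => w /=; rewrite fineK// Radon_Nikodym_fin_num.
have if_ : mu.-integrable setT f by exact: Radon_Nikodym_integrable.
have mf : measurable_fun setT f by exact: measurable_int if_.
have iPf : P.-integrable setT (f : Omega -> \bar R).
  apply/integrableP; split.
    exact: (measurableT_comp mf measurable_sub_id).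
  have /integrableP[_] := if_; rewrite ge0_integral_distribution//.
  exact: measurableT_comp.
exists (fine \o f); split.
- by apply/measurable_wrtP; apply: measurableT_comp.
- by rewrite -fE.
- move=> A GA; have mA : measurable (A : set GT) by rewrite /measurable/= GE.
  have -> : (\int[P]_(w in A) (X w)%:E)%E = nu A by [].
  rewrite (Radon_Nikodym_integral numu mA) -/f.
  rewrite /mu /distribution integral_pushforward//=.
  - by apply: eq_integral => w _; rewrite {2}fE.
  - exact: measurable_sub_id.
  - apply: (integrableS measurableT) => //; exact: sub_sigma_measurable.
Qed.

Lemma cond_expectationP X : measurable_fun setT X -> ae_bounded P X ->
  is_cond_expectation P G X (cond_expectation P G X).
Proof.
move=> mX bX; apply: (@xgetPex _ _ [set Y | is_cond_expectation P G X Y]).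
by apply: cond_expectation_exists; exact: ae_bounded_integrable.
Qed.

Lemma measurable_wrt_lt X Y : measurable_wrt G X -> measurable_wrt G Y ->
  G [set w | X w < Y w].
Proof.
move=> /measurable_wrtP mX /measurable_wrtP mY.
rewrite -GE -[X in <<s _ >> X]setTI.
exact: (@measurable_fun_ltr _ GT _ _ _ _ mX mY measurableT [set true]).
Qed.

Lemma measurable_wrt_cst (r : R) : measurable_wrt G (cst r).
Proof. by apply/measurable_wrtP. Qed.

Lemma ae_le_of_integral_le X Y : measurable_wrt G X -> measurable_wrt G Y ->
  P.-integrable setT (EFin \o X) -> P.-integrable setT (EFin \o Y) ->
  (forall A, G A ->
    (\int[P]_(w in A) (X w)%:E <= \int[P]_(w in A) (Y w)%:E)%E) ->
  \forall w \ae P, X w <= Y w.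
Proof.
move=> mX mY iX iY XY.
apply: ae_le_measure0; [exact: measurable_wrt_measurable..|].
have GA := measurable_wrt_lt _ _ mY mX.
have mA := sub_sigma_measurable _ GA.
have iXA : P.-integrable [set w | Y w < X w] (EFin \o X) by apply: integrableS iX.
have iYA : P.-integrable [set w | Y w < X w] (EFin \o Y) by apply: integrableS iY.
apply: (measure0_of_integral_le0 _ _ (fun w => X w - Y w)) => //.
- exact: (integrableB mA iXA iYA).
- by move=> w /=; rewrite subr_gt0.
- under eq_integral do rewrite EFinB.
  rewrite integralB// leeBlDr ?add0e ?XY//.
  exact: integrable_fin_num.
Qed.

(** Translates the acceptability condition on conditional expectations into
    inequalities between integrals, which is the only form used below. *)
Lemma cond_expectation_le0P X : measurable_fun setT X -> ae_bounded P X ->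
  (\forall w \ae P, cond_expectation P G X w <= 0) <->
  (forall A, G A -> (\int[P]_(w in A) (X w)%:E <= 0)%E).
Proof.
move=> mX bX; have [mE iE XE] := cond_expectationP _ mX bX.
split=> [E0 A GA|X0].
  rewrite -XE//.
  have mA := sub_sigma_measurable _ GA.
  have -> : 0%E = (\int[P]_(w in A) (0%R)%:E)%E by rewrite integral0.
  apply: ae_le_integral => //; last exact: integrable0.
  exact: integrableS iE.
apply: (ae_le_of_integral_le _ (cst 0)) => //; first exact: measurable_wrt_cst.
  exact: integrable0.
by move=> A GA; rewrite XE// integral0 X0.
Qed.

End sub_sigma_algebra.

Section pull_out.
Import HBSimple HBNNSimple.
Context {R : realType} {disp : measure_display} {Omega : measurableType disp}.
Variables (P : probability Omega R) (G : set (set Omega)).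
Hypothesis hG : complete_sub_sigma_algebra P G.
Let GT := g_sigma_algebraType G.

(** Taking out what is known. For [Z] the indicator of a set of [G] this is the
    hypothesis, for simple [Z] it follows by linearity, and in general [Z] is the
    increasing limit of [G]-measurable simple functions, so that [D * Z]
    dominates the approximations. *)
Lemma integral_mul_measurable_wrt_eq0 (D Z : Omega -> R) :
  P.-integrable setT (EFin \o D) -> measurable_wrt G Z ->
  (forall w, 0 <= Z w) ->
  P.-integrable setT (EFin \o (fun w => D w * Z w)) ->
  (forall A, G A -> (\int[P]_(w in A) (D w)%:E = 0)%E) ->
  forall A, G A -> (\int[P]_(w in A) (D w * Z w)%:E = 0)%E.
Proof.
move=> iD mZ Z0 iDZ D0 A GA.
have GE : <<s G >> = G by apply: sigma_algebra_id; case: hG.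
have mZE : measurable_fun (setT : set GT) (EFin \o Z : GT -> \bar R).
  by apply/measurable_EFinP; apply/(measurable_wrtP _ _ hG).
(* The approximation is carried out on the coarse measurable space, so that
   the level sets of [h n] belong to [G]. *)
pose h : nat -> {nnsfun GT >-> R} := nnsfun_approx measurableT mZE.
have mA := sub_sigma_measurable _ _ hG _ GA.
have iDA : P.-integrable A (EFin \o D) by apply: integrableS iD.
have hE n w : h n w =
    \sum_(r <- fset_set (range (h n))) r * \1_(h n @^-1` [set r]) w.
  by rewrite fimfunE fsbig_finite.
have Gh n r : G (h n @^-1` [set r]).
  have GP (B : set GT) : measurable B -> G B.
    by move=> mB; rewrite -GE.
  by apply: GP; rewrite -[X in measurable X]setTI; exact: measurable_funPT.
have mh n : measurable_fun setT (h n : Omega -> R).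
  apply: (measurable_wrt_measurable _ _ hG); apply/(measurable_wrtP _ _ hG).
  exact: measurable_funPT.
have DB n r : (fun w => (D w * (r * \1_(h n @^-1` [set r]) w))%:E) =
    (fun w => r%:E * ((EFin \o D) \_ (h n @^-1` [set r])) w)%E.
  by apply/funext => w; rewrite epatch_indic/= -!EFinM mulrCA.
have mB n r : measurable (h n @^-1` [set r] : set Omega).
  exact: (sub_sigma_measurable _ _ hG _ (Gh n r)).
have iDB n r : P.-integrable A ((EFin \o D) \_ (h n @^-1` [set r])).
  apply/integrable_restrict => //.
  by apply: integrableS iD => //; exact: measurableI.
have Dh0 n : (\int[P]_(w in A) (D w * h n w)%:E = 0)%E.
  under eq_integral do rewrite hE mulr_sumr -sumEFin.
  rewrite integral_sum//= => [|r].
    apply: big1 => r _; rewrite DB integralZl//.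
    by rewrite -integral_mkcondr D0 ?mule0//; apply: (sub_sigmaI _ _ hG).
  by rewrite DB; apply: integrableZl.
have := @dominated_convergence _ _ _ P A mA
  (fun n w => (D w * h n w)%:E) (fun w => (D w * Z w)%:E)
  (fun w => `|(D w * Z w)%:E|%E).
have mD : measurable_fun A D by apply/measurable_EFinP; exact: measurable_int iDA.
case=> //.
- move=> n; apply/measurable_EFinP; apply: measurable_funM => //.
  exact: measurable_funTS.
- exact: measurable_funTS (measurable_int _ iDZ).
- apply: aeW => w _; under eq_fun do rewrite EFinM.
  rewrite EFinM; apply: cvgeZl => //.
  by apply: (cvg_nnsfun_approx measurableT mZE) => // v _; rewrite lee_fin.
- by apply: integrable_abse; exact: integrableS iDZ.
- apply: aeW => w n _; rewrite lee_fin !normrM ler_wpM2l//.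
  rewrite !ger0_norm// -lee_fin /h nnsfun_approxE.
  by apply: (le_approx _ (fun v => _)) => //= v _; rewrite lee_fin.
move=> _ _ /=; under eq_fun do rewrite Dh0.
move=> /(cvg_unique (@ereal_hausdorff R)) => /(_ _ (cvg_cst _)).
exact.
Qed.
End pull_out.

(** * Essential infima as roots of the conditional expected loss *)

Section family_essential_infimum.
Context {R : realType} {disp : measure_display} {Omega : measurableType disp}.
Variable P : probability Omega R.
Implicit Types (S : set (Omega -> R)) (Y Z : Omega -> R).

Lemma family_ess_inf_ae_unique S Y Z :
  is_family_ess_inf P S Y -> is_family_ess_inf P S Z ->
  \forall w \ae P, Y w = Z w.
Proof.
move=> [mY YS Ymax] [mZ ZS Zmax].
apply: filterS2 (Zmax _ mY YS) (Ymax _ mZ ZS) => w YZ ZY.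
by apply/eqP; rewrite eq_le YZ.
Qed.

Lemma family_ess_infP S Y : is_family_ess_inf P S Y ->
  is_family_ess_inf P S (family_ess_inf P S).
Proof.
by move=> SY; apply: (@xgetPex _ _ [set Z | is_family_ess_inf P S Z]); exists Y.
Qed.
End family_essential_infimum.

Section bounded_compositions.
Context {R : realType} {disp : measure_display} {Omega : measurableType disp}.
Variable P : probability Omega R.
Implicit Types (X Y : Omega -> R) (l : R -> R).

Lemma ae_bounded_sub X Y : ae_bounded P X -> ae_bounded P Y ->
  ae_bounded P (fun w => X w - Y w).
Proof.
move=> [C XC] [D YD]; exists (C + D); apply: filterS2 XC YD => w h1 h2.
by rewrite (le_trans (ler_normB _ _))// lerD.
Qed.

Lemma ae_bounded_comp l X : {homo l : x y / x <= y} -> ae_bounded P X ->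
  ae_bounded P (fun w => l (X w)).
Proof.
move=> lnd [C XC]; exists (`|l C| + `|l (- C)|).
apply: filterS XC => w; rewrite ler_norml => /andP[/lnd h1 /lnd h2].
have := ler_norm (l C); have := ler_norm (- l (- C)).
have := normr_ge0 (l C); have := normr_ge0 (l (- C)).
by rewrite normrN ler_norml => *; apply/andP; split; lra.
Qed.

Lemma measurable_comp_sub l X Y : {homo l : x y / x <= y} ->
  measurable_fun setT X -> measurable_fun setT Y ->
  measurable_fun setT (fun w => l (X w - Y w)).
Proof.
move=> lnd mX mY; apply: measurableT_comp; last exact: measurable_funB.
exact: nondecreasing_measurable.
Qed.
End bounded_compositions.

Section conditional_shortfall.
Context {R : realType} {disp : measure_display} {Omega : measurableType disp}.
Variables (P : probability Omega R) (G : set (set Omega)).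
Hypothesis hG : complete_sub_sigma_algebra P G.
Variable l : R -> R.
Hypothesis hinc : {homo l : x y / x < y}.

Definition acceptable (X : Omega -> R) : set (Omega -> R) :=
  [set m | Linfty P G m /\
     \forall w \ae P, cond_expectation P G (fun w' => l (X w' - m w')) w <= 0].

Variables X Y : Omega -> R.
Hypotheses (mX : measurable_fun setT X) (bX : ae_bounded P X).
Hypothesis hY : Linfty P G Y.
Hypothesis root : forall A, G A -> (\int[P]_(w in A) (l (X w - Y w))%:E = 0)%E.

Let lnd : {homo l : x y / x <= y}. Proof. exact: ltW_homo. Qed.

Let mloss m : Linfty P G m -> measurable_fun setT (fun w => l (X w - m w)).
Proof.
case=> mm _; apply: measurable_comp_sub => //.
exact: (measurable_wrt_measurable _ _ hG).
Qed.

Let bloss m : Linfty P G m -> ae_bounded P (fun w => l (X w - m w)).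
Proof. by case=> _ bm; apply: ae_bounded_comp => //; exact: ae_bounded_sub. Qed.

(** [Y] is acceptable. If an acceptable [m] were smaller on a set [A] of
    positive probability, then [A] would belong to [G], and there
    [l (X - m) > l (X - Y)] would force the integral of [l (X - m)] over [A] to be
    positive. So [Y] is a smallest element of the acceptable set. *)
Lemma root_is_family_ess_inf : is_family_ess_inf P (acceptable X) Y.
Proof.
have mY : measurable_fun setT Y by apply: (measurable_wrt_measurable _ _ hG); case: hY.
have SY : acceptable X Y.
  split=> //; apply/(cond_expectation_le0P _ _ hG); [exact: mloss|exact: bloss|].
  by move=> A GA; rewrite root.
split=> // [m [Lm]|Z mZ]; last exact.
have mm : measurable_fun setT m by apply: (measurable_wrt_measurable _ _ hG); case: Lm.
move/(cond_expectation_le0P _ _ hG _ (mloss _ Lm) (bloss _ Lm)) => Em.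
apply: ae_le_measure0 => //.
have GA : G [set w | m w < Y w].
  by apply: (measurable_wrt_lt _ _ hG) => //; [case: Lm|case: hY].
have mA := sub_sigma_measurable _ _ hG _ GA.
have int n : Linfty P G n ->
    P.-integrable [set w | m w < Y w] (EFin \o (fun w => l (X w - n w))).
  by move=> Ln; apply: ae_bounded_integrable => //; [exact: mloss|exact: bloss].
apply: (measure0_of_integral_le0 _ _ (fun w => l (X w - m w) - l (X w - Y w))) => //.
- have -> : EFin \o (fun w => l (X w - m w) - l (X w - Y w)) =
    ((EFin \o (fun w => l (X w - m w))) \- (EFin \o (fun w => l (X w - Y w))))%E by [].
  by apply: integrableB => //; exact: int.
- by move=> w /= mY'; rewrite subr_gt0 hinc// ltrD2l ltrN2.
- under eq_integral do rewrite EFinB.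
  by rewrite integralB//; [rewrite root// sube0 Em|exact: int|exact: int].
Qed.

Lemma shortfall_root_ae :
  \forall w \ae P, family_ess_inf P (acceptable X) w = Y w.
Proof.
apply: family_ess_inf_ae_unique root_is_family_ess_inf.
exact: family_ess_infP root_is_family_ess_inf.
Qed.

Lemma shortfall_root_Linfty : Linfty P G (family_ess_inf P (acceptable X)).
Proof.
have [mE _ _] := family_ess_infP _ _ _ root_is_family_ess_inf.
apply: Linfty_ae hY mE _ => //.
by apply: filterS shortfall_root_ae => w ->.
Qed.
End conditional_shortfall.

(** * The augmented filtration and stopping times *)

Section filtration.
Context {R : realType} {disp : measure_display} {Omega : measurableType disp}.
Variables (P : probability Omega R) (d : nat) (T : R).
Variable W : R -> 'I_d -> Omega -> R.
Hypothesis hT : 0 < T.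
Hypothesis hW : brownian_motion P T W.

Local Notation F := (augmented_filtration P W).

Lemma past_events_measurable t : t <= T -> past_events W t `<=` measurable.
Proof.
move=> tT _ [s [i [B [/andP[s0 st] mB ->]]]].
have [mW _ _ _ _] := hW; rewrite -[X in measurable X]setTI.
by apply: mW => //; rewrite s0 (le_trans st).
Qed.

Lemma augmented_filtration_sub_sigma t : t <= T ->
  complete_sub_sigma_algebra P (F t).
Proof.
move=> tT; split.
- exact: smallest_sigma_algebra.
- apply: smallest_sub; first exact: sigma_algebra_measurable.
  by move=> A [/past_events_measurable|[]//]; exact.
- by move=> N mN N0; apply: sub_sigma_algebra; right.
Qed.

Lemma augmented_filtration_nondecreasing s t : s <= t -> F s `<=` F t.
Proof.
move=> st; apply: sub_sigma_algebra2; apply: setSU.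
move=> _ [r [i [B [/andP[r0 rs] mB ->]]]]; exists r, i, B; split=> //.
by rewrite r0 (le_trans rs).
Qed.

Lemma stopped_sigma_algebra_sub_sigma tau : stopping_time P T W tau ->
  complete_sub_sigma_algebra P (stopped_sigma_algebra P T W tau).
Proof.
move=> [tau0T Ftau].
have hF t : t <= T -> complete_sub_sigma_algebra P (F t).
  exact: augmented_filtration_sub_sigma.
have hFT := hF T (lexx _).
split.
- split.
  + split=> [|t /andP[_ tT]]; rewrite ?set0I; first by case: hFT => -[].
    by case: (hF t tT) => -[].
  + move=> A [FA FAt]; rewrite setTD; split; first exact: (sub_sigmaC _ _ hFT).
    move=> t t0T; have /andP[_ tT] := t0T.
    have -> : ~` A `&` [set w | tau w <= t] =
        [set w | tau w <= t] `&` ~` (A `&` [set w | tau w <= t]).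
      by rewrite setCI setIUr setICr setU0 setIC.
    apply: (sub_sigmaI _ _ (hF t tT)); first exact: Ftau.
    by apply: (sub_sigmaC _ _ (hF t tT)); exact: FAt.
  + move=> A FA; split.
      by case: hFT => -[_ _ FU] _ _; apply: FU => n; case: (FA n).
    move=> t t0T; have /andP[_ tT] := t0T; rewrite setI_bigcupl.
    case: (hF t tT) => -[_ _ FU] _ _; apply: FU => n.
    by case: (FA n) => _ /(_ t t0T).
- by move=> A [FA _]; exact: (sub_sigma_measurable _ _ hFT).
- move=> N mN N0; split; first exact: (sub_sigma_null _ _ hFT).
  move=> t t0T; have /andP[_ tT] := t0T.
  apply: (sub_sigmaI _ _ (hF t tT)); last exact: Ftau.
  exact: (sub_sigma_null _ _ (hF t tT)).
Qed.

Lemma stopped_sigma_algebra_nondecreasing sigma tau :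
  stopping_time P T W tau -> (forall w, sigma w <= tau w) ->
  stopped_sigma_algebra P T W sigma `<=` stopped_sigma_algebra P T W tau.
Proof.
move=> [_ Ftau] st A [FA FAt]; split=> // t t0T; have /andP[_ tT] := t0T.
have -> : A `&` [set w | tau w <= t] =
    (A `&` [set w | sigma w <= t]) `&` [set w | tau w <= t].
  rewrite -setIA; congr (_ `&` _); apply/seteqP; split=> w /= => [h|[]//].
  by split=> //; exact: le_trans h.
apply: (sub_sigmaI _ _ (augmented_filtration_sub_sigma _ tT)).
  exact: FAt.
exact: Ftau.
Qed.

Lemma stopping_time_cst s : 0 <= s <= T -> stopping_time P T W (cst s).
Proof.
move=> s0T; split=> // t /andP[_ tT] /=.
have hF := augmented_filtration_sub_sigma _ tT.
have [st|st] := boolP (s <= t).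
  rewrite (_ : [set w | _] = setT); first exact: (sub_sigmaT _ _ hF).
  by apply/seteqP; split.
rewrite (_ : [set w | _] = set0); last by apply/seteqP; split.
by case: hF => -[].
Qed.

Lemma stopped_sigma_algebra_cst s : 0 <= s <= T ->
  stopped_sigma_algebra P T W (cst s) = F s.
Proof.
move=> s0T; apply/seteqP; split=> A.
  move=> [_ /(_ s s0T)]; rewrite (_ : [set w | _] = setT) ?setIT//.
  by apply/seteqP; split=> //= w _ /=; exact: lexx.
have /andP[s0 sT] := s0T.
move=> FA; split; first exact: augmented_filtration_nondecreasing FA.
move=> t /andP[t0 tT]; have hF := augmented_filtration_sub_sigma _ tT.
have [st|st] := boolP (s <= t).
  rewrite (_ : [set w | _] = setT) ?setIT; last by apply/seteqP; split.
  exact: augmented_filtration_nondecreasing FA.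
rewrite (_ : [set w | _] = set0) ?setI0; last by apply/seteqP; split.
by case: hF => -[].
Qed.

End filtration.

(** * Brownian events *)

Section normal_quantile.
Context {R : realType}.
Variable s : R.
Hypothesis s0 : s != 0.
Local Notation N := (normal_prob (0 : R) s).
Let F (u : R) : R := fine (N `]-oo, u]).

Let FE u : (F u)%:E = N `]-oo, u].
Proof. by rewrite fineK// fin_num_measure. Qed.

(** The density of the normal law is bounded by its peak. *)
Let F_lip u v : u <= v -> 0 <= F v - F u <= normal_peak s * (v - u).
Proof.
rewrite le_eqVlt => /predU1P[->|uv]; first by rewrite !subrr mulr0 lexx.
have E : (F v - F u)%:E = N `]u, v].
  rewrite EFinB !FE.
  rewrite (_ : `]-oo, v]%classic = `]-oo, u] `|` `]u, v]); last first.
    by rewrite (@itv_bndbnd_setU _ _ -oo%O (BRight u) (BRight v))// bnd_simp ltW.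
  rewrite measureU//=.
    by rewrite addeAC subee ?add0e// fin_num_measure.
  apply/seteqP; split=> x //=; rewrite !in_itv/= => -[xu /andP[ux _]].
  by have := lt_le_trans ux xu; rewrite ltxx.
rewrite -!lee_fin E; apply/andP; split; first exact: measure_ge0.
apply: (@le_trans _ _ (\int[lebesgue_measure]_(x in `]u, v]) (normal_peak s)%:E)%E).
  apply: ge0_le_integral => //=.
  - by move=> x _; rewrite lee_fin normal_pdf_ge0.
  - by apply/measurable_EFinP; apply: measurable_funTS; exact: measurable_normal_pdf.
  - by move=> x _; rewrite lee_fin normal_pdf_ub.
rewrite integral_cst//= lebesgue_measure_itv/= lte_fin uv.
by rewrite -EFinB -EFinM.
Qed.

Let F_continuous : continuous F.
Proof.
move=> a; have K0 := normal_peak_gt0 s0.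
apply/cvgrPdist_le => /= e e0; near=> x.
have xae : `|a - x| < e / normal_peak s.
  by near: x; apply: (@nbhsx_ballx _ _ a (e / normal_peak s)); rewrite divr_gt0.
rewrite ltr_pdivlMr// mulrC in xae.
apply: le_trans (ltW xae); have [ax|ax] := leP a x.
  have /andP[h1 h2] := F_lip _ _ ax.
  by rewrite distrC (distrC a) !ger0_norm// subr_ge0.
have /andP[h1 h2] := F_lip _ _ (ltW ax).
by rewrite !ger0_norm// subr_ge0 ltW.
Unshelve. all: by end_near.
Qed.

(** The intermediate value theorem for the distribution function. *)
Lemma normal_quantile q : 0 < q < 1 -> exists u, N `]-oo, u] = q%:E.
Proof.
move=> /andP[q0 q1].
have mid : measurable_fun setT (id : measurableTypeR R -> R) by exact: measurable_id.
pose X : {RV N >-> R} := @mfun_Sub _ _ (measurableTypeR R) R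
  (id : measurableTypeR R -> R) (mem_set mid).
have FcdfE : F = fine \o cdf X.
  by apply/funext => u; rewrite /= /cdf /distribution /pushforward preimage_id.
have [a Fa] : exists a, F a < q.
  have /fine_cvg/cvgr_lt/(_ q q0) := cvg_cdfNy0 X.
  by rewrite -FcdfE => /filter_ex.
have [b Fb] : exists b, q < F b.
  have /fine_cvg/cvgr_gt/(_ q q1) := cvg_cdfy1 X.
  by rewrite -FcdfE => /filter_ex.
have ab : a <= b.
  rewrite leNgt; apply/negP => /ltW/F_lip /andP[+ _].
  by rewrite subr_ge0 leNgt (lt_trans Fa).
have [c _ Fc] : exists2 c, c \in `[a, b] & F c = q.
  apply: IVT => //; first exact: continuous_subspaceT.
  by rewrite minElt maxElt (lt_trans Fa Fb) !ltW.
by exists c; rewrite -FE Fc.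
Qed.
End normal_quantile.

Section brownian_events.
Context {R : realType} {disp : measure_display} {Omega : measurableType disp}.
Variables (P : probability Omega R) (d : nat) (T : R).
Variable W : R -> 'I_d -> Omega -> R.
Hypothesis hd : (0 < d)%N.
Hypothesis hT : 0 < T.
Hypothesis hW : brownian_motion P T W.

Lemma measure_ae_iff (A B : set Omega) : measurable A -> measurable B ->
  (\forall w \ae P, A w <-> B w) -> P A = P B.
Proof.
move=> mA mB AB; rewrite -(setIT A) -(setIT B) -!integral_indic//.
apply: ae_eq_integral => //.
- exact/measurable_EFinP.
- exact/measurable_EFinP.
apply: filterS AB => w AB _; congr (_%:E); rewrite !indicE.
by congr (_%:R); congr nat_of_bool; apply/idP/idP => /[!inE] /AB.
Qed.

(** The events with this property form a sigma-algebra containing both the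
    past events and the null sets. *)
Lemma augmented_filtration_ae_natural s A : augmented_filtration P W s A ->
  exists2 A', natural_filtration W s A' & \forall w \ae P, A w <-> A' w.
Proof.
have [N0 NC NU] : sigma_algebra setT (natural_filtration W s).
  exact: smallest_sigma_algebra.
move: A; apply: smallest_sub.
  split.
  - by exists set0 => //; apply: aeW.
  - move=> A [A' NA' AA']; exists (setT `\` A'); first exact: NC.
    by apply: filterS AA' => w AA' /=; split=> -[_ h]; split=> // /AA'.
  - move=> A hA.
    have /choice[A' hA'] : forall n, exists A', natural_filtration W s A' /\
        \forall w \ae P, A n w <-> A' w.
      by move=> n; have [B ? ?] := hA n; exists B.
    exists (\bigcup_n A' n); first by apply: NU => n; case: (hA' n).
    have : forall n, \forall w \ae P, A n w <-> A' n w by move=> n; case: (hA' n).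
    move=> /ae_foralln; apply: filterS => w AA'.
    by split=> -[n _ /AA' h]; exists n.
move=> A [pA|[mA A0]]; first by exists A; [exact: sub_sigma_algebra|exact: aeW].
exists set0 => //; exists A; split=> // w /= h.
by apply: contrapT => nA; apply: h.
Qed.

(** Augmentation does not destroy the independence of the increments, because
    it changes the events of the past by null sets only. *)
Lemma augmented_filtration_independent s t A C :
  0 <= s -> s < t -> t <= T -> augmented_filtration P W s A ->
  measurable C -> increment_events W s t C -> P (A `&` C) = (P A * P C)%E.
Proof.
move=> s0 st tT FA mC IC; have sT : s <= T by rewrite (le_trans (ltW st)).
have [A' NA' AA'] := augmented_filtration_ae_natural _ _ FA.
have [_ _ indep _ _] := hW.
have hF := augmented_filtration_sub_sigma _ _ _ _ hW _ sT.
have mA := sub_sigma_measurable _ _ hF _ FA.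
have mA' : measurable A'.
  move: NA'; apply: smallest_sub; first exact: sigma_algebra_measurable.
  exact: past_events_measurable hW _ sT.
rewrite (measure_ae_iff _ _ _ _ AA')//.
rewrite -(indep s t)//; apply: measure_ae_iff; [exact: measurableI..|].
by apply: filterS AA' => w AA' /=; split=> -[/AA'].
Qed.

(** The Brownian motion starts at [0], so every event generating the
    sigma-algebra at time [0] is almost surely true or almost surely false. *)
Lemma augmented_filtration0_trivial A : augmented_filtration P W 0 A ->
  P A = 0%E \/ P A = 1%E.
Proof.
have [mW W0 _ _ _] := hW.
suff : augmented_filtration P W 0 `<=`
    [set A | (\forall w \ae P, A w) \/ (\forall w \ae P, ~ A w)].
  move=> h FA.
  have mA := sub_sigma_measurable _ _
    (augmented_filtration_sub_sigma _ _ _ _ hW _ (ltW hT)) _ FA.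
  case: (h _ FA) => hA; [right|left].
    rewrite -(probability_setT P); apply: measure_ae_iff => //.
    by apply: filterS hA => w; split.
  rewrite -(measure0 P); apply: measure_ae_iff => //.
  by apply: filterS hA => w nA; split.
clear A; apply: smallest_sub.
  split.
  - by right; apply: aeW => w.
  - move=> A [hA|hA]; [right|left]; apply: filterS hA => w hAw /=.
      by case=> _; apply.
    by [].
  - move=> A hA.
    have [[n hn]|hn] := pselect (exists n, \forall w \ae P, A n w).
      by left; apply: filterS hn => w; exists n.
    right; have : forall n, \forall w \ae P, ~ A n w.
      by move=> n; case: (hA n) => // hAn; exfalso; apply: hn; exists n.
    by move=> /ae_foralln; apply: filterS => w h [n _ /h].
move=> A [[s [i [B [/andP[s0 s0'] mB ->]]]]|[mA A0]].
  have -> : s = 0 by apply/eqP; rewrite eq_le s0'.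
  have [B0|B0] := pselect (B 0); [left|right];
    by apply: filterS (W0 i) => w /= ->.
right; exists A; split=> // w /= h.
by apply: contrapT => nA; apply: h.
Qed.

(** A half-space for one coordinate of the increment, whose law is normal. *)
Lemma increment_event_of_probability s t q : 0 <= s -> s < t -> t <= T ->
  0 < q < 1 -> exists C, [/\ measurable C, increment_events W s t C &
    P C = q%:E].
Proof.
move=> s0 st tT q01.
have ts0 : Num.sqrt (t - s) != 0 by rewrite gt_eqF// sqrtr_gt0 subr_gt0.
have [u Nu] := normal_quantile _ ts0 _ q01.
have [mW _ _ law _] := hW.
pose i0 : 'I_d := Ordinal hd.
pose B (i : 'I_d) : set R := if i == i0 then `]-oo, u]%classic else setT.
have mB i : measurable (B i) by rewrite /B; case: ifP.
exists ((fun w => W t i0 w - W s i0 w) @^-1` `]-oo, u]); split.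
- rewrite -[X in measurable X]setTI; apply: measurable_funB => //; apply: mW.
    by rewrite (le_trans s0 (ltW st)).
  by rewrite s0 (le_trans (ltW st)).
- by apply: sub_sigma_algebra; exists i0, `]-oo, u]%classic.
- have := law s t s0 st tT B mB.
  rewrite (bigD1 i0)//= /B eqxx Nu big1 ?mule1; last first.
    by move=> i /negbTE ->; rewrite probability_setT.
  move=> <-; congr (P _); apply/seteqP; split=> w /=.
    by move=> h i; case: eqVneq => [->|].
  by move=> /(_ i0); rewrite eqxx.
Qed.
End brownian_events.

(** * Sufficiency: quasi-arithmetic conditional means *)

(** Here [phi] is the identity or [x |-> expR (2 * beta * x)], [psi] its inverse
    and [zeta] the positive factor that remains when [l (x - y)] is divided by
    [phi x - phi y]. *)
Section quasi_arithmetic_mean.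
Context {R : realType} {disp : measure_display} {Omega : measurableType disp}.
Variables (P : probability Omega R) (l phi psi zeta : R -> R).
Hypothesis hinc : {homo l : x y / x < y}.
Hypothesis phi_inc : {mono phi : x y / x <= y}.
Hypothesis mpsi : measurable_fun setT psi.
Hypothesis phiK : forall C v, phi (- C) <= v <= phi C -> phi (psi v) = v.
Hypothesis mzeta : measurable_fun setT zeta.
Hypothesis zeta_ge0 : forall x, 0 <= zeta x.
Hypothesis lE : forall x y, l (x - y) = (phi x - phi y) * zeta y.

(** [phi (Y)] is a conditional expectation of [phi (X)] given [G]. *)
Definition is_quasi_mean (G : set (set Omega)) (X Y : Omega -> R) :=
  Linfty P G Y /\ forall A, G A ->
    (\int[P]_(w in A) (phi (Y w))%:E = \int[P]_(w in A) (phi (X w))%:E)%E.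

Let phi_nd : {homo phi : x y / x <= y}. Proof. by move=> x y; rewrite phi_inc. Qed.
Let mphi : measurable_fun setT phi. Proof. exact: nondecreasing_measurable. Qed.

Section fixed_sigma_algebra.
Variable G : set (set Omega).
Hypothesis hG : complete_sub_sigma_algebra P G.
Variable X : Omega -> R.
Hypotheses (mX : measurable_fun setT X) (bX : ae_bounded P X).

Let mphiX : measurable_fun setT (fun w => phi (X w)).
Proof. exact: measurableT_comp. Qed.

Let bphiX : ae_bounded P (fun w => phi (X w)). Proof. exact: ae_bounded_comp. Qed.

(** The conditional expectation of [phi (X)] stays, like [phi (X)], in an interval
    on which [psi] inverts [phi]. *)
Lemma quasi_mean_exists : exists Y, is_quasi_mean G X Y.
Proof.
have [mV iV VE] := cond_expectationP _ _ hG _ mphiX bphiX.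
set V := cond_expectation _ _ _ in mV iV VE.
have [C XC] := bX.
have iphiX A : measurable A -> P.-integrable A (EFin \o (fun w => phi (X w))).
  by move=> mA; exact: ae_bounded_integrable.
have icst A r : measurable A -> P.-integrable A (EFin \o cst r).
  exact: finite_measure_integrable_cst.
have VC : \forall w \ae P, phi (- C) <= V w <= phi C.
  have V1 : \forall w \ae P, cst (phi (- C)) w <= V w.
    apply: (ae_le_of_integral_le _ _ hG) => //; first exact: (measurable_wrt_cst _ _ hG).
      exact: icst.
    move=> A GA; have mA := sub_sigma_measurable _ _ hG _ GA; rewrite VE//.
    apply: ae_le_integral => //; [exact: icst|exact: iphiX|].
    by apply: filterS XC => w /=; rewrite ler_norml => /andP[? _]; rewrite phi_nd.
  have V2 : \forall w \ae P, V w <= cst (phi C) w.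
    apply: (ae_le_of_integral_le _ _ hG) => //; first exact: (measurable_wrt_cst _ _ hG).
      exact: icst.
    move=> A GA; have mA := sub_sigma_measurable _ _ hG _ GA; rewrite VE//.
    apply: ae_le_integral => //; [exact: iphiX|exact: icst|].
    by apply: filterS XC => w /=; rewrite ler_norml => /andP[_ ?]; rewrite phi_nd.
  by apply: filterS2 V1 V2 => w /= -> ->.
exists (fun w => psi (V w)); split.
  split.
    apply/(measurable_wrtP _ _ hG); apply: measurableT_comp => //.
    exact/(measurable_wrtP _ _ hG).
  exists C; apply: filterS VC => w VwC.
  by rewrite ler_norml -(phi_inc (- C)) -(phi_inc (psi _)) (phiK _ _ VwC).
move=> A GA; rewrite -VE//; have mA := sub_sigma_measurable _ _ hG _ GA.
have mV' := measurable_wrt_measurable _ _ hG _ mV.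
apply: ae_eq_integral => //.
- apply/measurable_EFinP; apply: measurable_funTS.
  by apply: measurableT_comp => //; exact: measurableT_comp.
- by apply/measurable_EFinP; apply: measurable_funTS.
- by apply: filterS VC => w VwC _ /=; rewrite (phiK _ _ VwC).
Qed.

(** [phi (X) - phi (Y)] has integral zero over the sets of [G], and multiplying it
    by the [G]-measurable [zeta (Y)] preserves this. *)
Lemma quasi_mean_root Y : is_quasi_mean G X Y ->
  forall A, G A -> (\int[P]_(w in A) (l (X w - Y w))%:E = 0)%E.
Proof.
move=> [[mY bY] YX] A GA; under eq_integral do rewrite lE.
have mY' := measurable_wrt_measurable _ _ hG _ mY.
have mphiY : measurable_fun setT (fun w => phi (Y w)) by exact: measurableT_comp.
have bphiY : ae_bounded P (fun w => phi (Y w)) by exact: ae_bounded_comp.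
apply: (integral_mul_measurable_wrt_eq0 _ _ hG
          (fun w => phi (X w) - phi (Y w)) (fun w => zeta (Y w))) => //.
- apply: ae_bounded_integrable => //; first exact: measurable_funB.
  exact: ae_bounded_sub.
- apply/(measurable_wrtP _ _ hG); apply: measurableT_comp => //.
  exact/(measurable_wrtP _ _ hG).
- have -> : (fun w => (phi (X w) - phi (Y w)) * zeta (Y w)) =
      (fun w => l (X w - Y w)) by apply/funext => w; rewrite lE.
  apply: ae_bounded_integrable => //.
    by apply: measurable_comp_sub => //; exact: ltW_homo.
  by apply: ae_bounded_comp; [exact: ltW_homo|exact: ae_bounded_sub].
- move=> B GB; have mB := sub_sigma_measurable _ _ hG _ GB.
  under eq_integral do rewrite EFinB.
  rewrite integralB//; [|exact: ae_bounded_integrable..].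
  rewrite YX// subee//; apply: integrable_fin_num => //.
  exact: ae_bounded_integrable.
Qed.

End fixed_sigma_algebra.

(** The tower property: if [phi (Y)] is a conditional expectation of [phi (X)] and
    [phi (Z)] one of [phi (Y)] given less information, then [phi (Z)] is also one
    of [phi (X)]. *)
Lemma quasi_mean_time_consistent (d : nat) (T : R) (W : R -> 'I_d -> Omega -> R) :
  brownian_motion P T W ->
  time_consistent P T W (shortfall_risk_measure P T W l).
Proof.
move=> hW iota sigma tau siota ssigma stau le1 le2 X [mX bX].
have hF t := stopped_sigma_algebra_sub_sigma P d T W hW t.
have mX' := measurable_wrt_measurable _ _ (hF _ stau) _ mX.
have [Y qY] := quasi_mean_exists _ (hF _ ssigma) _ mX' bX.
have rY := quasi_mean_root _ (hF _ ssigma) _ mX' bX _ qY.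
have VY := shortfall_root_ae _ _ (hF _ ssigma) _ hinc _ _ mX' bX qY.1 rY.
have [mV bV] := shortfall_root_Linfty _ _ (hF _ ssigma) _ hinc _ _ mX' bX qY.1 rY.
rewrite -/(shortfall_risk_measure P T W l sigma tau X) in VY mV bV.
set V := shortfall_risk_measure P T W l sigma tau X in VY mV bV *.
have mV' := measurable_wrt_measurable _ _ (hF _ ssigma) _ mV.
have [Z [LZ ZV]] := quasi_mean_exists _ (hF _ siota) _ mV' bV.
have rZ := quasi_mean_root _ (hF _ siota) _ mV' bV _ (conj LZ ZV).
have qZ : is_quasi_mean (stopped_sigma_algebra P T W iota) X Z.
  split=> // A FA; rewrite ZV// -qY.2; last first.
    exact: (stopped_sigma_algebra_nondecreasing _ _ _ _ hW iota sigma).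
  have mA := sub_sigma_measurable _ _ (hF _ siota) _ FA.
  have mY := measurable_wrt_measurable _ _ (hF _ ssigma) _ qY.1.1.
  apply: ae_eq_integral => //.
  - by apply/measurable_EFinP; apply: measurable_funTS; exact: measurableT_comp.
  - by apply/measurable_EFinP; apply: measurable_funTS; exact: measurableT_comp.
  - by apply: filterS VY => w + _ /= => ->.
have rZ' := quasi_mean_root _ (hF _ siota) _ mX' bX _ qZ.
have h1 := shortfall_root_ae _ _ (hF _ siota) _ hinc _ _ mV' bV LZ rZ.
have h2 := shortfall_root_ae _ _ (hF _ siota) _ hinc _ _ mX' bX LZ rZ'.
by apply: filterS2 h1 h2 => w e1 e2; rewrite [LHS]e1 [RHS]e2.
Qed.
End quasi_arithmetic_mean.

Lemma exponential_or_linear_time_consistent {R : realType}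
    {disp : measure_display} {Omega : measurableType disp}
    (P : probability Omega R) (d : nat) (T : R) (W : R -> 'I_d -> Omega -> R)
    (l : R -> R) (beta c : R) :
  brownian_motion P T W -> {homo l : x y / x < y} -> 0 <= beta -> 0 < c ->
  (forall x, l x = c * (if beta != 0 then expR (2 * beta * x) - 1 else x)) ->
  time_consistent P T W (shortfall_risk_measure P T W l).
Proof.
move=> hW hinc beta0 c0 lE; have [b0|b0] := eqVneq beta 0.
  apply: (quasi_mean_time_consistent P l id id (cst c)) => //.
  - by move=> x; exact: ltW.
  - by move=> x y; rewrite lE b0 eqxx/= mulrC.
have b2 : 0 < 2 * beta by rewrite mulr_gt0// lt_neqAle eq_sym b0.
have b2n0 := lt0r_neq0 b2.
apply: (quasi_mean_time_consistent P l (fun x => expR (2 * beta * x))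
  (fun v => ln v / (2 * beta)) (fun y => c * expR (- (2 * beta * y)))) => //.
- by move=> x y; rewrite ler_expR ler_pM2l.
- by apply: measurable_funM => //; exact: measurable_ln.
- move=> C v /andP[v0 _]; rewrite mulrC divfK// lnK// posrE.
  by apply: lt_le_trans v0; exact: expR_gt0.
- apply: measurable_funM => //; apply: measurableT_comp => //.
  by apply: measurableT_comp => //; exact: measurable_funM.
- by move=> x; rewrite mulr_ge0 ?expR_ge0// ltW.
- move=> x y; rewrite lE b0 [2 * beta * (_ - _)]mulrBr expRD expRN mulrCA.
  congr (_ * _).
  by rewrite mulrBl mulfV ?gt_eqF ?expR_gt0.
Qed.

(** * Necessity: three-valued payoffs *)

Section three_valued_payoffs.
Context {R : realType} {disp : measure_display} {Omega : measurableType disp}.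
Variable P : probability Omega R.
Implicit Types (A B C : set Omega) (a b c : R).

(** Payoffs of this form are stable under the loss: subtracting a constant and
    applying [l] only changes the three values. *)
Definition three_valued A B a b c (w : Omega) : R :=
  if w \in A then (if w \in B then a else b) else c.

Lemma three_valuedE A B a b c : three_valued A B a b c =
  (fun w => a * \1_(A `&` B) w + b * \1_(A `\` B) w + c * \1_(~` A) w).
Proof.
apply/funext => w; rewrite /three_valued !indicE in_setI in_setD in_setC.
by case: (w \in A); case: (w \in B); rewrite /= !(mulr1, mulr0, addr0, add0r).
Qed.

Lemma three_valued_bounded A B a b c : ae_bounded P (three_valued A B a b c).
Proof.
exists (`|a| + `|b| + `|c|); apply: aeW => w; rewrite /three_valued.
have := normr_ge0 a; have := normr_ge0 b; have := normr_ge0 c.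
by case: ifP => _; [case: ifP => _|]; lra.
Qed.

Lemma three_valued_Linfty G A B a b c : complete_sub_sigma_algebra P G ->
  G A -> G B -> Linfty P G (three_valued A B a b c).
Proof.
move=> hG GA GB; split; last exact: three_valued_bounded.
apply/(measurable_wrtP _ _ hG).
have mG C : G C -> measurable (C : set (g_sigma_algebraType G)).
  by move=> GC; apply: sub_sigma_algebra.
have mA := mG _ GA; have mB := mG _ GB.
rewrite three_valuedE.
apply: measurable_funD; first apply: measurable_funD.
- apply: measurable_funM => //.
  by apply: (@measurable_indic _ (g_sigma_algebraType G)); exact: measurableI.
- apply: measurable_funM => //.
  by apply: (@measurable_indic _ (g_sigma_algebraType G)); exact: measurableD.
- apply: measurable_funM => //.
  by apply: (@measurable_indic _ (g_sigma_algebraType G)); exact: measurableC.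
Qed.

Lemma integral_three_valued A B C a b c :
  measurable A -> measurable B -> measurable C ->
  (\int[P]_(w in C) (three_valued A B a b c w)%:E =
   a%:E * P (C `&` (A `&` B)) + b%:E * P (C `&` (A `\` B))
     + c%:E * P (C `\` A))%E.
Proof.
move=> mA mB mC; rewrite three_valuedE.
have iind E r : measurable E -> P.-integrable C (fun w => (r%:E * (\1_E w)%:E)%E).
  move=> mE; apply: integrableZl => //.
  by apply: integrableS (integrable_indic P mE).
have ind E r : measurable E ->
    (\int[P]_(w in C) (r%:E * (\1_E w)%:E) = r%:E * P (C `&` E))%E.
  move=> mE; rewrite integralZl//; last first.
    by apply: integrableS (integrable_indic P mE).
  by rewrite integral_indic// setIC.
have mAB : measurable (A `&` B) by exact: measurableI.
have mAB' : measurable (A `\` B) by exact: measurableD.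
have mA' : measurable (~` A) by exact: measurableC.
under eq_integral do rewrite !EFinD !EFinM.
rewrite integralD//; last 2 first.
- by apply: integrableD => //; exact: iind.
- exact: iind.
rewrite integralD//; [|exact: iind..].
by rewrite !ind// -setDE.
Qed.
End three_valued_payoffs.

Section necessity.
Context {R : realType} {disp : measure_display} {Omega : measurableType disp}.
Variables (P : probability Omega R) (d : nat) (T : R).
Variable W : R -> 'I_d -> Omega -> R.
Hypothesis hd : (0 < d)%N.
Hypothesis hT : 0 < T.
Hypothesis hW : brownian_motion P T W.
Variable l : R -> R.
Hypothesis hinc : {homo l : x y / x < y}.
Hypothesis cl : convex_function (setT : set R^o) l.
Hypothesis l0 : l 0 = 0.

Local Notation F := (augmented_filtration P W).
Local Notation rho := (shortfall_risk_measure P T W l).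

Let lnd : {homo l : x y / x <= y}. Proof. exact: ltW_homo. Qed.

Lemma increment_events_augmented s t : 0 <= s -> s <= t -> t <= T ->
  increment_events W s t `<=` F t.
Proof.
move=> s0 st tT; have hF := augmented_filtration_sub_sigma P d T W hW t tT.
apply: smallest_sub; first by case: hF.
have mW r i : 0 <= r <= t -> measurable_wrt (F t) (W r i).
  by move=> rt B mB; apply: sub_sigma_algebra; left; exists r, i, B.
move=> _ [i [B [mB ->]]].
have /(measurable_wrtP _ _ hF) mt := mW t i ltac:(by rewrite (le_trans s0 st) lexx).
have /(measurable_wrtP _ _ hF) ms := mW s i ltac:(by rewrite s0 st).
have : measurable_wrt (F t) (fun w => W t i w - W s i w).
  by apply/(measurable_wrtP _ _ hF); exact: measurable_funB.
exact.
Qed.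

(** At time [0] an event either is negligible or carries the whole integral. *)
Lemma augmented_filtration0_integral0 f : measurable_fun setT f ->
  ae_bounded P f -> (\int[P]_w (f w)%:E = 0)%E ->
  forall A, F 0 A -> (\int[P]_(w in A) (f w)%:E = 0)%E.
Proof.
move=> mf bf f0 A FA.
have hF := augmented_filtration_sub_sigma P d T W hW 0 (ltW hT).
have mA := sub_sigma_measurable _ _ hF _ FA.
have [A0|A1] := augmented_filtration0_trivial P d T W hT hW A FA.
  apply: null_set_integral => //; apply/measurable_EFinP.
  exact: measurable_funTS.
have CA0 : P (~` A) = 0%E by rewrite probability_setC// A1 subee.
have := @negligible_integral _ _ _ P setT (~` A) (EFin \o f).
rewrite setTD setCK => <-//; first exact: measurableC.
exact: ae_bounded_integrable.
Qed.

Lemma shortfall_time0 k X : measurable_fun setT X -> ae_bounded P X ->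
  (\int[P]_w (l (X w - k))%:E = 0)%E ->
  forall tau, \forall w \ae P, rho (cst 0) tau X w = k.
Proof.
move=> mX bX k0 tau.
have z0T : 0 <= (0 : R) <= T by rewrite lexx ltW.
have hF := augmented_filtration_sub_sigma P d T W hW 0 (ltW hT).
have F0E := stopped_sigma_algebra_cst P d T W hW 0 z0T.
rewrite /shortfall_risk_measure F0E.
apply: (shortfall_root_ae _ _ hF l hinc X (cst k)) => //.
  split; first exact: (measurable_wrt_cst _ _ hF).
  by exists `|k|; apply: aeW.
apply: augmented_filtration0_integral0 => //.
  by apply: measurable_comp_sub.
apply: ae_bounded_comp => //; apply: ae_bounded_sub => //.
by exists `|k|; apply: aeW.
Qed.

(** The intermediate value theorem, between levels [M] above and [- M] below all
    three values of the payoff. *)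
Lemma shortfall_level_exists p q x y z : 0 < p < 1 -> 0 < q < 1 ->
  exists k, p * (q * l (x - k) + (1 - q) * l (y - k)) + (1 - p) * l (z - k) = 0.
Proof.
move=> /andP[p0 p1] /andP[q0 q1].
pose f k := p * (q * l (x - k) + (1 - q) * l (y - k)) + (1 - p) * l (z - k).
pose M := `|x| + `|y| + `|z|.
have hx : - M <= x <= M.
  have := ler_norm x; have := ler_norm (- x); rewrite normrN /M.
  by have := normr_ge0 y; have := normr_ge0 z; move=> *; apply/andP; split; lra.
have hy : - M <= y <= M.
  have := ler_norm y; have := ler_norm (- y); rewrite normrN /M.
  by have := normr_ge0 x; have := normr_ge0 z; move=> *; apply/andP; split; lra.
have hz : - M <= z <= M.
  have := ler_norm z; have := ler_norm (- z); rewrite normrN /M.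
  by have := normr_ge0 x; have := normr_ge0 y; move=> *; apply/andP; split; lra.
have lneg u : u <= M -> l (u - M) <= 0 by move=> uM; rewrite -l0 lnd// subr_le0.
have lpos u : - M <= u -> 0 <= l (u - - M) by move=> uM; rewrite -l0 lnd// subr_ge0.
case/andP: hx => hx1 hx2; case/andP: hy => hy1 hy2; case/andP: hz => hz1 hz2.
have fM : f M <= 0.
  have := lneg _ hx2; have := lneg _ hy2; have := lneg _ hz2; rewrite /f => c b a.
  have : q * l (x - M) + (1 - q) * l (y - M) <= 0 by nra.
  nra.
have fN : 0 <= f (- M).
  have := lpos _ hx1; have := lpos _ hy1; have := lpos _ hz1; rewrite /f => c b a.
  have : 0 <= q * l (x - - M) + (1 - q) * l (y - - M) by nra.
  nra.
have lc := convex_increasing_continuous l hinc cl.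
have fc : continuous f.
  have lsub u : continuous (fun k => l (u - k)).
    move=> k; apply: continuous_comp; last exact: lc.
    by apply: cvgB; [exact: cvg_cst|exact: cvg_id].
  move=> k; apply: cvgD; (apply: cvgM; first exact: cvg_cst); last exact: lsub.
  by apply: cvgD; (apply: cvgM; first exact: cvg_cst); exact: lsub.
have [k _ fk] : exists2 k, k \in `[- M, M] & f k = 0.
  apply: IVT; [exact: le_trans hx2|exact: continuous_subspaceT|].
  by rewrite ge_min le_max fM fN orbT.
by exists k.
Qed.

(** The independence axiom of decision theory. The payoff is a lottery between
    [x] and [y], drawn after time [T / 2], on an event [A] of probability [p] known
    at time [T / 2], and it is [z] off [A]. The equation for [x], [y], [q] says that
    the lottery has risk [0] at time [T / 2]; the equation for [k] says that the
    payoff worth [0] on [A] and [z] off [A] has risk [k] at time [0]. By time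
    consistency the original payoff has risk [k] too, and comparing the equations
    that define the two risks leaves the conclusion. *)
Lemma time_consistent_substitution : time_consistent P T W rho ->
  forall x y z k p q : R, 0 < p < 1 -> 0 < q < 1 ->
    q * l x + (1 - q) * l y = 0 ->
    p * l (- k) + (1 - p) * l (z - k) = 0 ->
    q * l (x - k) + (1 - q) * l (y - k) = l (- k).
Proof.
move=> tc x y z k p q p01 q01 qxy pkz.
pose s := T / 2.
have s0 : 0 < s by rewrite divr_gt0.
have sT : s < T by by rewrite /s ltr_pdivrMr// ltr_pMr// ltr1n.
have z0T : 0 <= (0 : R) <= T by rewrite lexx ltW.
have s0T : 0 <= s <= T by rewrite !ltW.
have T0T : 0 <= T <= T by rewrite lexx ltW.
have hFs := augmented_filtration_sub_sigma P d T W hW s (ltW sT).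
have hFT := augmented_filtration_sub_sigma P d T W hW T (lexx _).
have FsE := stopped_sigma_algebra_cst P d T W hW s s0T.
have FTE := stopped_sigma_algebra_cst P d T W hW T T0T.
have [A [mA IA PA]] := increment_event_of_probability P d T W hd hW 0 s p
  (lexx _) s0 (ltW sT) p01.
have [B [mB IB PB]] := increment_event_of_probability P d T W hd hW s T q
  (ltW s0) sT (lexx _) q01.
have FA : F s A := increment_events_augmented 0 s (lexx _) (ltW s0) (ltW sT) _ IA.
have FB : F T B := increment_events_augmented s T (ltW s0) (ltW sT) (lexx _) _ IB.
have indep D : F s D -> P (D `&` B) = (P D * q%:E)%E.
  move=> FD; rewrite -PB.
  exact: (augmented_filtration_independent P d T W hW s T D B (ltW s0) sT).
have indepC D : F s D -> P (D `\` B) = (P D * (1 - q)%:E)%E.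
  move=> FD; have mD := sub_sigma_measurable _ _ hFs _ FD.
  rewrite measureD//=; last by rewrite -ge0_fin_numE// fin_num_measure.
  by rewrite indep// EFinB muleBr// ?mule1// fin_num_measure.
(* [Y] is the risk of [X] at time [T / 2]. *)
pose X := three_valued A B x y z.
pose Y := three_valued A A 0 0 z.
have LX : Linfty P (F T) X.
  apply: three_valued_Linfty => //.
  exact: (augmented_filtration_nondecreasing P d W s T (ltW sT) _ FA).
have LY : Linfty P (F s) Y by exact: three_valued_Linfty.
have mX := measurable_wrt_measurable _ _ hFT _ LX.1.
have bX := LX.2.
have rootY C : F s C -> (\int[P]_(w in C) (l (X w - Y w))%:E = 0)%E.
  move=> FC; have mC := sub_sigma_measurable _ _ hFs _ FC.
  have E w : l (X w - Y w) = three_valued A B (l x) (l y) 0 w.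
    rewrite /X /Y /three_valued; case: (w \in A); last by rewrite subrr.
    by rewrite !subr0; case: ifP.
  under eq_integral do rewrite E.
  rewrite integral_three_valued// mul0e adde0.
  have FCA := sub_sigmaI _ _ hFs _ _ FC FA.
  rewrite setIA indep// setIDA indepC//.
  have <- : (fine (P (C `&` A)))%:E = P (C `&` A).
    by rewrite fineK// fin_num_measure//; exact: measurableI.
  rewrite -!EFinM -EFinD; congr (_%:E).
  rewrite mulrCA (mulrCA (l y)) -mulrDr mulrC (mulrC (l x)) (mulrC (l y)).
  by rewrite qxy mul0r.
have rhoY : \forall w \ae P, rho (cst s) (cst T) X w = Y w.
  by rewrite /shortfall_risk_measure FsE; exact: (shortfall_root_ae _ _ hFs l hinc).
have [mV bV] : Linfty P (F s) (rho (cst s) (cst T) X).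
  rewrite /shortfall_risk_measure FsE.
  exact: (shortfall_root_Linfty _ _ hFs l hinc X Y).
have mV' := measurable_wrt_measurable _ _ hFs _ mV.
have rho0V : \forall w \ae P, rho (cst 0) (cst s) (rho (cst s) (cst T) X) w = k.
  apply: shortfall_time0 => //.
  transitivity (\int[P]_w (three_valued A A (l (- k)) (l (- k)) (l (z - k)) w)%:E)%E.
    apply: ae_eq_integral => //.
    - apply/measurable_EFinP; exact: (measurable_comp_sub l _ (cst k)).
    - apply/measurable_EFinP.
      apply: (measurable_wrt_measurable _ _ hFs).
      by apply: (three_valued_Linfty P _ _ _ _ _ _ _ _ _).1.
    - apply: filterS rhoY => w -> _ /=; rewrite /Y /three_valued.
      by case: (w \in A); rewrite ?sub0r.
  rewrite integral_three_valued// !setTI setIid setDv measure0 mule0 adde0.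
  rewrite setTD probability_setC// PA -EFinB -!EFinM -EFinD.
  by rewrite mulrC (mulrC (l (z - k))) pkz.
have [k' k'0] : exists k',
    p * (q * l (x - k') + (1 - q) * l (y - k')) + (1 - p) * l (z - k') = 0.
  exact: shortfall_level_exists.
have rho0X : \forall w \ae P, rho (cst 0) (cst T) X w = k'.
  apply: shortfall_time0 => //.
  have E w : l (X w - k') =
      three_valued A B (l (x - k')) (l (y - k')) (l (z - k')) w.
    rewrite /X /three_valued; case: (w \in A) => //.
    by case: ifP.
  under eq_integral do rewrite E.
  rewrite integral_three_valued// !setTI.
  rewrite indep// indepC// setTD probability_setC// PA -EFinB -!EFinM -!EFinD.
  by congr (_%:E); rewrite -k'0; ring.
have kk' : k = k'.
  have LXT : Linfty P (stopped_sigma_algebra P T W (cst T)) X by rewrite FTE.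
  have := tc (cst 0) (cst s) (cst T) (stopping_time_cst P d T W hW _ z0T)
    (stopping_time_cst P d T W hW _ s0T) (stopping_time_cst P d T W hW _ T0T)
    (fun _ => ltW s0) (fun _ => ltW sT) X LXT.
  move=> h; apply: contrapT => kk'.
  have [N [mN N0 sub]] : \forall w \ae P, False.
    apply: filterS3 h rho0V rho0X => w e1 e2 e3; apply: kk'.
    by rewrite -e2 -e3 e1.
  have : P setT = 0%E by apply: (subset_measure0 _ mN _ N0) => // w _; exact: sub.
  by rewrite probability_setT => /eqP; rewrite onee_eq0.
rewrite -kk' in k'0.
have /andP[p0 p1] := p01.
apply: (mulfI (lt0r_neq0 p0)); lra.
Qed.

(** The weight [q] that makes the lottery between [x] and [y] neutral is
    [- l y / (l x - l y)]. Any shift [h] can be reached as [- k], by choosing [z]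
    with [l (z + h)] and [l h] of opposite signs and [p] accordingly. *)
Lemma time_consistent_exchange : time_consistent P T W rho ->
  forall x y h, y < 0 -> 0 < x ->
    l x * (l (y + h) - l h) = l y * (l (x + h) - l h).
Proof.
move=> tc x y h y0 x0.
have lx : 0 < l x by rewrite -l0 hinc.
have ly : l y < 0 by rewrite -l0 hinc.
have weight (a b : R) : 0 < a -> b < 0 -> 0 < - b / (a - b) < 1.
  move=> a0 b0; have ab : 0 < a - b by lra.
  by rewrite divr_gt0 ?oppr_gt0// ltr_pdivrMr// mul1r; lra.
have [->|h0] := eqVneq h 0; first by rewrite !addr0 l0 !subr0 mulrC.
have [z [p [p01 pz]]] : exists z p : R,
    0 < p < 1 /\ p * l h + (1 - p) * l (z + h) = 0.
  have [hlt|hgt|h00] := ltgtP h 0; last by rewrite h00 eqxx in h0.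
  - have lh : l h < 0 by rewrite -l0 hinc.
    have l1 : 0 < l 1 by rewrite -l0 hinc.
    exists (1 - h), (1 - (- l h / (l 1 - l h))); split.
      by have := weight _ _ l1 lh => /andP[? ?]; apply/andP; split; lra.
    by rewrite subrK; field; lra.
  - have lh : 0 < l h by rewrite -l0 hinc.
    have l1 : l (- 1) < 0 by rewrite -l0 hinc// ltrN10.
    exists (- 1 - h), (- l (- 1) / (l h - l (- 1))); split; first exact: weight.
    by rewrite subrK; field; lra.
have := time_consistent_substitution tc x y z (- h) p (- l y / (l x - l y)) p01
  (weight _ _ lx ly).
rewrite !opprK => /(_ _ pz) => e.
have lxy : l x - l y != 0 by lra.
have {}e := e ltac:(by field).
have : (l x - l y) * (- l y / (l x - l y) * l (x + h) +
    (1 - - l y / (l x - l y)) * l (y + h)) = (l x - l y) * l h by rewrite e.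
have -> : (l x - l y) * (- l y / (l x - l y) * l (x + h) +
    (1 - - l y / (l x - l y)) * l (y + h)) = - l y * l (x + h) + l x * l (y + h).
  by field.
by move=> e'; lra.
Qed.
End necessity.

(** * The characterization *)

Theorem theorem4p2 (R : realType) (disp : measure_display)
  (Omega : measurableType disp) (P : probability Omega R)
  (d : nat) (hd : (0 < d)%N) (T : R) (hT : 0 < T)
  (W : R -> 'I_d -> Omega -> R) (hW : brownian_motion P T W)
  (l : R -> R) (hl : loss_function l) (hinc : {homo l : x y / x < y}) :
  time_consistent P T W (shortfall_risk_measure P T W l) <->
  exists2 beta : R, 0 <= beta &
    (* a loss function matters only up to a positive factor: l and c * l
       define the same risk measure *)
    exists2 c : R, 0 < c &
      forall x, l x = c * (if beta != 0 then expR (2 * beta * x) - 1 else x).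
Proof.
have [_ cl _ l0] := hl; split=> [tc|[beta beta0 [c c0 lE]]].
  apply: exponential_or_linear => //.
  exact: (time_consistent_exchange P d T W hd hT hW l hinc cl l0 tc).
exact: (exponential_or_linear_time_consistent P d T W l beta c).
Qed.
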